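(* Let $X$ be a non-empty locally connected $T_1$-space. If no (connected) component of $X$ is compact, then $X$ has a $T_1$ one-point connectification.
   Context: A space $X$ is locally connected if for every $x\in X$, every neighborhood of $x$ in $X$ contains a connected neighborhood of $x$ in $X$. A space $Y$ is an extension of a space $X$ if $Y$ contains $X$ as a dense subspace; it is a one-point extension if moreover $Y\setminus X$ is a singleton. A one-point connectification of $X$ is a one-point extension of $X$ that is connected. Compact is not assumed to include the Hausdorff property. *)

(* Defs.v *)
From mathcomp Require Import all_boot all_order all_algebra.
From mathcomp Require Import all_classical.
From mathcomp Require Import topology.

Set Implicit Arguments.
Unset Strict Implicit.
Unset Printing Implicit Defensive.

Local Open Scope classical_set_scope.

(* Neighborhoods are not required to be open. *)
Definition locally_connected (T : topologicalType) : Prop :=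
  forall (x : T) (U : set T), nbhs x U ->
    exists V : set T, [/\ nbhs x V, connected V & V `<=` U].

(* "Y contains X as a subspace" is expressed through an injection f of X into Y
   under which the open sets of X are exactly the traces of those of Y. *)
Definition subspace_embedding (X Y : topologicalType) (f : X -> Y) : Prop :=
  injective f /\
  forall U : set X, open U <-> exists2 V : set Y, open V & U = f @^-1` V.

Definition extension (X Y : topologicalType) (f : X -> Y) : Prop :=
  subspace_embedding f /\ dense (range f).

Definition one_point_extension (X Y : topologicalType) (f : X -> Y) : Prop :=
  extension f /\ exists p : Y, ~` range f = [set p].

Definition one_point_connectification (X Y : topologicalType) (f : X -> Y)
    : Prop :=
  one_point_extension f /\ connected [set: Y].

(* Main.v *)
(* Each component C of X, being non-compact, carries proper filters containing C
   that have no cluster point in C. Let G be the intersection of all these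
   filters, over all components. Every member of G meets every component, while,
   X being T1, G contains the complement of every point. Adjoin to X a point
   whose neighborhoods have traces in G: the second property of G makes the
   extension T1, and the first one puts the new point in the closure of every
   component, so that the extension is connected. *)

Require Import Defs.
From HB Require Import structures.
From mathcomp Require Import all_boot all_order all_algebra.
From mathcomp Require Import all_classical.
From mathcomp Require Import topology.

Local Open Scope classical_set_scope.

(** The type records [G] so that each filter puts its own topology on [option X]; [None] is the new
    point. *)
Definition adjoin_point {X : topologicalType} (G : filter_on X) : Type :=
  option X.

HB.instance Definition _ (X : topologicalType) (G : filter_on X) :=
  Choice.copy (adjoin_point G) (option X).

Definition adjoin_open {X : topologicalType} (G : filter_on X) :
    set_system (adjoin_point G) :=
  [set V | open (Some @^-1` V) /\ (V None -> filter G (Some @^-1` V))].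

Lemma adjoin_openT {X : topologicalType} (G : filter_on X) :
  adjoin_open G setT.
Proof. by split=> [|_]; rewrite preimage_setT; [exact: openT|exact: filterT]. Qed.

Lemma adjoin_openI {X : topologicalType} (G : filter_on X) :
  setI_closed (adjoin_open G).
Proof.
move=> A B [oA GA] [oB GB]; rewrite /adjoin_open /= preimage_setI.
by split=> [|[/GA ? /GB ?]]; [exact: openI|exact: filterI].
Qed.

Lemma adjoin_open_bigU {X : topologicalType} (G : filter_on X) (I : Type)
    (V : I -> set (adjoin_point G)) :
  (forall i, adjoin_open G (V i)) -> adjoin_open G (\bigcup_i V i).
Proof.
move=> oV; rewrite /adjoin_open /= preimage_bigcup; split.
  by apply: bigcup_open => i _; have [] := oV i.
move=> [i _ Vi]; apply: filterS (proj2 (oV i) Vi).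
by move=> x Vix; exists i.
Qed.

HB.instance Definition _ (X : topologicalType) (G : filter_on X) :=
  isOpenTopological.Build (adjoin_point G)
    (adjoin_openT G) (adjoin_openI G) (@adjoin_open_bigU X G).

Definition adjoin_inj {X : topologicalType} (G : filter_on X) :
  X -> adjoin_point G := Some.

Lemma adjoin_openE {X : topologicalType} (G : filter_on X)
    (V : set (adjoin_point G)) :
  open V <->
  open (adjoin_inj G @^-1` V) /\ (V None -> filter G (adjoin_inj G @^-1` V)).
Proof. by []. Qed.

Lemma preimage_adjoin_inj_image {X : topologicalType} (G : filter_on X)
    (U : set X) : adjoin_inj G @^-1` (adjoin_inj G @` U) = U.
Proof. by apply/seteqP; split=> [x [y Uy [<-]]|x Ux] //; exists x. Qed.

Lemma open_adjoin_inj_image {X : topologicalType} (G : filter_on X)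
    (U : set X) : open U -> open (adjoin_inj G @` U).
Proof.
move=> oU; apply/adjoin_openE; split; last by case.
by rewrite preimage_adjoin_inj_image.
Qed.

(** Properness of [G] is what gives density: an open set around [None] has its trace in [G], hence a
    non-empty trace. *)
Lemma adjoin_point_one_point_extension {X : topologicalType}
    (G : filter_on X) :
  ~ filter G set0 -> one_point_extension (adjoin_inj G).
Proof.
move=> G0; split; last first.
  exists None; apply/seteqP; split=> [[x /= []|//]|_ -> [x _ //]].
  by exists x.
split.
  split=> [x y []//|U]; split=> [oU|[V /adjoin_openE[oV _] ->]//].
  exists (adjoin_inj G @` U); first exact: open_adjoin_inj_image.
  by rewrite preimage_adjoin_inj_image.
move=> V [[x|] Vy] /adjoin_openE[_ GV]; first by exists (Some x); split=> //; exists x.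
have [x Vx] : adjoin_inj G @^-1` V !=set0.
  by apply/set0P/eqP => V0; apply: G0; rewrite -V0; exact: GV.
by exists (Some x); split=> //; exists x.
Qed.

Lemma adjoin_point_accessible {X : topologicalType} (G : filter_on X) :
  accessible_space X -> (forall x, filter G (~` [set x])) ->
  accessible_space (adjoin_point G).
Proof.
move=> T1 Gx [x|] [y|] // xy.
- have [|A [oA /set_mem Ax /set_mem Ay]] := T1 x y.
    by apply: contra_neq xy => ->.
  exists (adjoin_inj G @` A); split; first exact: open_adjoin_inj_image.
    by apply/mem_set; exists x.
  by apply/mem_set => -[z Az [zy]]; apply: Ay; rewrite -zy.
(* The copy of [X] is itself open, which separates [Some x] from [None]. *)
- exists (range (adjoin_inj G)); split.
  + exact/open_adjoin_inj_image/openT.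
  + by apply/mem_set; exists x.
  + by apply/mem_set => -[].
(* Conversely, removing [Some y] leaves a neighborhood of [None], by the assumption on [G]. *)
- have E : adjoin_inj G @^-1` (~` [set Some y]) = ~` [set y].
    by apply/seteqP; split=> z /= zy zE; apply: zy; [rewrite zE|case: zE].
  exists (~` [set Some y]); split.
  + apply/adjoin_openE; rewrite E; split=> [|_]; last exact: Gx.
    exact/closed_openC/(accessible_closed_set1 T1).
  + exact/mem_set.
  + by apply/mem_set => /(_ erefl).
Qed.

Lemma connected_component_sub_clopen {X : topologicalType} (B : set X) (x : X) :
  clopen B -> B x -> connected_component [set: X] x `<=` B.
Proof.
move=> [oB cB] Bx.
have CB : connected_component [set: X] x `&` B = connected_component [set: X] x.
  apply: (@component_connected _ [set: X] x).
  - by exists x; split=> //; exact: connected_component_refl.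
  - by exists B.
  - by exists B.
by rewrite -CB; exact: subIsetr.
Qed.

Lemma adjoin_point_connected {X : topologicalType} (G : filter_on X) :
  (forall (A : set X) (x : X), filter G A ->
    A `&` connected_component [set: X] x !=set0) ->
  connected [set: adjoin_point G].
Proof.
move=> Gmeet.
(* If a clopen [B] contained [Some x] but not [None], the trace of its complement would lie in [G]
   and so meet the component of [x], which is contained in the trace of [B]. *)
have clopen_None (B : set (adjoin_point G)) (x : X) :
    clopen B -> B (Some x) -> B None.
  move=> [oB /closed_openC oBC] Bx; apply: contrapT => NB.
  have /adjoin_openE[ofBC /(_ NB) GB] := oBC.
  have [y [nBy Cy]] := Gmeet _ x GB.
  apply: nBy; move: Cy.
  apply: (@connected_component_sub_clopen _ (adjoin_inj G @^-1` B)) => //.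
  split; first by have /adjoin_openE[] := oB.
  by rewrite -[X in closed X]setCK; exact: open_closedC.
move=> B [b Bb] [C oC]; rewrite setTI => BC [D cD]; rewrite setTI => BD.
have cB : clopen B by split; [rewrite BC|rewrite BD].
have BN : B None by case: b Bb => // x; exact: clopen_None.
(* A point of [X] missed by [B] would, by the same claim for the clopen complement, force [None] out
   of [B]. *)
apply/seteqP; split=> // -[x _|//]; apply: contrapT => nBx.
exact: (@clopen_None (~` B) x (clopenC B cB) nBx) BN.
Qed.

Definition escaping {X : topologicalType} (C : set X) (F : set_system X) :=
  [/\ ProperFilter F, F C & C `&` cluster F = set0].

Lemma not_compact_escaping {X : topologicalType} (C : set X) :
  ~ compact C -> exists F, escaping C F.
Proof.
move=> /existsNP[F] /not_implyP[PF] /not_implyP[FC] /set0P/negP.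
by rewrite negbK => /eqP C0; exists F.
Qed.

(** If [x] is outside [C], then [C] already lies in the complement of [x]. If [x] is in [C] and that
    complement is not in [F], every member of [F] contains [x], so [x] is a cluster point of [F] in
    [C], which is excluded. *)
Lemma escaping_setC1 {X : topologicalType} (C : set X) (F : set_system X)
    (x : X) : escaping C F -> F (~` [set x]).
Proof.
move=> [PF FC C0].
have [Cx|nCx] := pselect (C x); last first.
  by apply: filterS FC => y Cy yx; apply: nCx; rewrite -yx.
apply: contrapT => nF.
have : (C `&` cluster F) x; last by rewrite C0.
split=> // A B FA /nbhs_singleton Bx; exists x; split=> //.
apply: contrapT => nAx; apply: nF.
by apply: filterS FA => y Ay yx; apply: nAx; rewrite -yx.
Qed.

Definition escape_system (X : topologicalType) : set_system X :=
  [set A | forall x F,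
    escaping (connected_component [set: X] x) F -> F A].

Lemma escape_system_filter (X : topologicalType) : Filter (escape_system X).
Proof.
split=> [x F [PF _ _]|A B GA GB x F eF|A B AB GA x F eF].
- exact: filterT.
- by have [PF _ _] := eF; apply: filterI; [exact: GA eF|exact: GB eF].
- by have [PF _ _] := eF; apply: filterS AB _; exact: GA eF.
Qed.

(** Non-compactness supplies one escaping filter; it contains both [A] and the component, and it is
    proper. *)
Lemma escape_system_meets {X : topologicalType} (A : set X) (x : X) :
  ~ compact (connected_component [set: X] x) -> escape_system X A ->
  A `&` connected_component [set: X] x !=set0.
Proof.
move=> /not_compact_escaping[F eF] /(_ x F eF) FA.
by have [PF FC _] := eF; apply: (@filter_ex _ F); exact: filterI.
Qed.

Theorem theorem3p1 (X : topologicalType) (X_nonempty : [set: X] !=set0)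
    (X_lc : locally_connected X) (X_T1 : accessible_space X)
    (X_nc : forall x : X, ~ compact (connected_component [set: X] x)) :
  exists (Y : topologicalType) (f : X -> Y),
    one_point_connectification f /\ accessible_space Y.
Proof.
pose G := FilterType (escape_system X) (escape_system_filter X).
have Gmeet (A : set X) (x : X) :
    filter G A -> A `&` connected_component [set: X] x !=set0.
  exact: escape_system_meets.
exists (adjoin_point G), (adjoin_inj G); split; first split.
- apply: adjoin_point_one_point_extension => G0.
  (* With a point at hand there is a component, which the empty set cannot meet; hence [G] is
     proper. *)
  by have [x _] := X_nonempty; have [y []] := Gmeet _ x G0.
- exact: adjoin_point_connected.
- apply: adjoin_point_accessible => // x y F.
  exact: escaping_setC1.
Qed.
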